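(* Let $G$ be a graph that contains at least one of the following five graphs as a (not necessarily induced) subgraph: (a) the diamond; (b) the graph $H_b$ with vertices $u,v,w,x,a,b,y,z$ and edges $uv,vw,wu,ux,xa,au,xz,zy,yx,ab,wz,vb,by$; (c) $\overline{C_6}$ (the triangular prism); (d) the graph $H_d$ with vertices $u,v,w,x,y,z,a,b$ and edges $uv,vw,wu,xy,yz,zx,wz,vy,wa,ax,yb,bu,ab$; (e) the graph $H_e$ with vertices $u,v,w,x,y,z,a,b,c$ and edges $uv,vw,wu,xy,yz,zx,wz,vy,wa,ax,vc,cx,ab,bc,ub$. Then $G$ does not admit a colourful Eulerian orientation. In particular, if $G$ is $d$-regular, then $\chi_s(G)\geq\left\lceil\frac{d+5}{2}\right\rceil$.
   Context: The diamond is $K_4$ minus an edge. An Eulerian orientation of $G$ is an orientation in which every vertex has in-degree equal to out-degree. An Eulerian orientation $\vec G$ is a $q$-colourful Eulerian orientation if there is a proper $q$-colouring $f$ of $G$ such that for every vertex $v$: all in-neighbours of $v$ have the same colour $c_v$, no out-neighbour of $v$ has colour $c_v$, and the out-neighbours of $v$ have pairwise distinct colours. It is a colourful Eulerian orientation if it is $q$-colourful for some integer $q$. $\chi_s(G)$ is the least $k$ such that $G$ has a proper $k$-colouring in which no path on 4 vertices receives only two colours. *)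

(* Defs.v *)
From HB Require Import structures.
From mathcomp Require Import all_boot.

Set Implicit Arguments.
Unset Strict Implicit.
Unset Printing Implicit Defensive.

(* Finite simple undirected graphs. *)
Record sgraph := SGraph {
  vertex :> finType;
  adj : rel vertex;
  adj_sym : symmetric adj;
  adj_irrefl : irreflexive adj
}.
Arguments adj {s}.

Definition regular (G : sgraph) (d : nat) : Prop :=
  forall v : G, #|[set u | adj v u]| = d.

(* Not necessarily induced: only edges of H have to be preserved. *)
Definition contains (G H : sgraph) : Prop :=
  exists h : H -> G, injective h /\ forall x y, adj x y -> adj (h x) (h y).

Section EdgeList.
Variables (n : nat) (s : seq (nat * nat)).

Definition edge_rel (i j : 'I_n) : bool :=
  (i != j) &&
  (((i : nat, j : nat) \in s) || ((j : nat, i : nat) \in s)).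

Lemma edge_rel_sym : symmetric edge_rel.
Proof. by move=> i j; rewrite /edge_rel eq_sym orbC. Qed.

Lemma edge_rel_irrefl : irreflexive edge_rel.
Proof. by move=> i; rewrite /edge_rel eqxx. Qed.

Definition edge_graph : sgraph := SGraph edge_rel_sym edge_rel_irrefl.
End EdgeList.

Section Complement.
Variable G : sgraph.

Definition compl_rel (x y : G) : bool := (x != y) && ~~ adj x y.

Lemma compl_rel_sym : symmetric compl_rel.
Proof. by move=> x y; rewrite /compl_rel eq_sym adj_sym. Qed.

Lemma compl_rel_irrefl : irreflexive compl_rel.
Proof. by move=> x; rewrite /compl_rel eqxx. Qed.

Definition compl_graph : sgraph := SGraph compl_rel_sym compl_rel_irrefl.
End Complement.

(* K_4 on u, v, w, x with the edge ux removed. *)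
Definition diamond : sgraph :=
  let u := 0 in let v := 1 in let w := 2 in let x := 3 in
  edge_graph 4 [:: (u, v); (v, w); (w, u); (v, x); (w, x)].

Definition H_b : sgraph :=
  let u := 0 in let v := 1 in let w := 2 in let x := 3 in
  let a := 4 in let b := 5 in let y := 6 in let z := 7 in
  edge_graph 8 [:: (u, v); (v, w); (w, u); (u, x); (x, a); (a, u); (x, z);
                   (z, y); (y, x); (a, b); (w, z); (v, b); (b, y)].

Definition C_6 : sgraph :=
  edge_graph 6 [:: (0, 1); (1, 2); (2, 3); (3, 4); (4, 5); (5, 0)].

Definition H_d : sgraph :=
  let u := 0 in let v := 1 in let w := 2 in let x := 3 in
  let y := 4 in let z := 5 in let a := 6 in let b := 7 in
  edge_graph 8 [:: (u, v); (v, w); (w, u); (x, y); (y, z); (z, x); (w, z);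
                   (v, y); (w, a); (a, x); (y, b); (b, u); (a, b)].

Definition H_e : sgraph :=
  let u := 0 in let v := 1 in let w := 2 in let x := 3 in let y := 4 in
  let z := 5 in let a := 6 in let b := 7 in let c := 8 in
  edge_graph 9 [:: (u, v); (v, w); (w, u); (x, y); (y, z); (z, x); (w, z);
                   (v, y); (w, a); (a, x); (v, c); (c, x); (a, b); (b, c);
                   (u, b)].

Definition proper_coloring (G : sgraph) (q : nat) (f : G -> 'I_q) : bool :=
  [forall u, forall v, adj u v ==> (f u != f v)].

(* D u v means that the edge uv is oriented from u to v. *)
Definition orientation (G : sgraph) (D : rel G) : Prop :=
  (forall u v, D u v -> adj u v) /\
  (forall u v, adj u v -> D u v (+) D v u).

Definition Eulerian_orientation (G : sgraph) (D : rel G) : Prop :=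
  orientation D /\ forall v, #|[set u | D u v]| = #|[set w | D v w]|.

Definition q_colourful (q : nat) (G : sgraph) (D : rel G) : Prop :=
  Eulerian_orientation D /\
  exists f : G -> 'I_q,
    proper_coloring f /\
    forall v, exists c : 'I_q,
      [/\ forall u, D u v -> f u = c,
          forall w, D v w -> f w <> c
        & forall w w', D v w -> D v w' -> w <> w' -> f w <> f w'].

Definition colourful_Eulerian_orientation (G : sgraph) (D : rel G) : Prop :=
  exists q : nat, q_colourful q D.

Definition is_P4 (G : sgraph) (p : 4.-tuple G) : bool :=
  uniq p && sorted adj p.

Definition star_coloring (G : sgraph) (k : nat) (f : G -> 'I_k) : bool :=
  proper_coloring f &&
  [forall p : 4.-tuple G, is_P4 p ==> (2 < #|[set f x | x in p]|)].

Definition star_colorable (G : sgraph) (k : nat) : bool :=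
  [exists f : {ffun G -> 'I_k}, star_coloring f].

Lemma star_colorable_ex (G : sgraph) : exists k, star_colorable G k.
Proof.
exists #|G|; apply/existsP; exists [ffun x => enum_rank x].
apply/andP; split.
  apply/forallP => u; apply/forallP => v; apply/implyP => uv.
  rewrite !ffunE (inj_eq enum_rank_inj).
  by apply/eqP => euv; rewrite euv adj_irrefl in uv.
apply/forallP => p; apply/implyP => /andP[Up _].
rewrite card_imset; last by move=> x y; rewrite !ffunE; apply: enum_rank_inj.
by move/card_uniqP: Up => ->; rewrite size_tuple.
Qed.

Definition chi_s (G : sgraph) : nat := ex_minn (star_colorable_ex G).

(* Main.v *)
Require Import Defs.
From mathcomp Require Import all_boot.
From mathcomp Require Import zify.

Set Implicit Arguments.
Unset Strict Implicit.
Unset Printing Implicit Defensive.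

(* In a colourful Eulerian orientation, for a path x - v - y the vertices x and
   y have the same colour if and only if both edges point to v.  Hence triangles
   are directed cycles, and orienting the remaining edges of each of the five
   graphs leads to contradictory equalities and inequalities of colours.
   In a star colouring, orient the edges of every bicoloured path on three
   vertices towards its middle vertex.  Out-neighbours of v then receive
   distinct colours, all different from the colours of v and of its
   in-neighbours.  So outdegrees are at most k - 2, unless some indegree is 0,
   which forces k >= d + 1 and is excluded by d >= 3 when k <= (d + 4)/2.  As the
   average outdegree is d/2, equality then holds everywhere, and the orientation
   is a colourful Eulerian orientation. *)

(** * Contradictory colours in each of the five graphs *)

Section ForbiddenSubgraphs.

Variables (T : eqType) (C : Type) (e A : rel T) (f : T -> C).
Hypothesis arcP : forall x y, e x y -> A x y \/ A y x.
Hypothesis proper : forall x y, A x y -> f x <> f y.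
Hypothesis in_in : forall x v y, A x v -> A y v -> f x = f y.
Hypothesis in_out : forall x v y, A x v -> A v y -> f x <> f y.
Hypothesis out_out : forall x v y, A v x -> A v y -> x != y -> f x <> f y.

Let edges (s : seq (T * T)) := all (fun p => e p.1 p.2) s.

Ltac neq := first [done | by rewrite eq_sym].

Ltac new_eq x y :=
  lazymatch goal with
  | _ : f x = f y |- _ => fail
  | _ : f y = f x |- _ => fail
  | _ => idtac
  end.

Ltac new_neq x y :=
  lazymatch goal with
  | _ : f x <> f y |- _ => fail
  | _ : f y <> f x |- _ => fail
  | _ => idtac
  end.

(** Saturates the context with the colour relations forced by the known arcs. The guards [new_eq]
    and [new_neq] record each pair once, so the loop ends; [congruence] then looks for a clash. *)
Ltac colours :=
  repeat match goal with
  | a : is_true (A ?x ?y) |- _ => new_neq x y; have ? := proper a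
  | a : is_true (A ?x ?v), b : is_true (A ?y ?v) |- _ =>
      tryif unify x y then fail else (new_eq x y; have ? := in_in a b)
  | a : is_true (A ?x ?v), b : is_true (A ?v ?y) |- _ =>
      new_neq x y; have ? := in_out a b
  | a : is_true (A ?v ?x), b : is_true (A ?v ?y) |- _ =>
      tryif unify x y then fail
      else (new_neq x y; have ? : f x <> f y by apply: (out_out a b); neq)
  end;
  try (exfalso; congruence).

(** A triangle that is not a directed cycle has a sink. Its two in-neighbours there have equal
    colours although they are adjacent. *)
Lemma triangleP u v w : e u v -> e v w -> e w u ->
  [/\ A u v, A v w & A w u] \/ [/\ A v u, A w v & A u w].
Proof.
move=> /arcP[uv|vu] /arcP[vw|wv] /arcP[wu|uw]; do ?[by left|by right].
all: colours.
Qed.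

(** Here and in [arc], [colours] runs after each split, so that contradictory branches die before
    the next edge is oriented. *)
Ltac triangle u v w :=
  have [[? ? ?]|[? ? ?]] :
      [/\ A u v, A v w & A w u] \/ [/\ A v u, A w v & A u w]
    by [apply: triangleP]; colours.

Ltac arc u v :=
  have [?|?] : A u v \/ A v u by [apply: arcP]; colours.

Ltac unpack :=
  rewrite /edges /= !inE !negb_or -!andbA;
  repeat (case/andP=> ?); move=> ?; repeat (case/andP=> ?); move=> _.

(** Both triangles are directed cycles through the edge [vw]. So [u] and [x] are both in-neighbours
    of one end of it and both out-neighbours of the other: equal and distinct colours. *)
Lemma diamond_free u v w x : uniq [:: u; v; w; x] ->
  edges [:: (u, v); (v, w); (w, u); (v, x); (w, x)] -> False.
Proof. unpack; triangle u v w; arc v x; arc w x. Qed.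

Lemma H_b_free u v w x a b y z : uniq [:: u; v; w; x; a; b; y; z] ->
  edges [:: (u, v); (v, w); (w, u); (u, x); (x, a); (a, u); (x, z);
            (z, y); (y, x); (a, b); (w, z); (v, b); (b, y)] -> False.
Proof.
unpack; triangle u v w; triangle u x a; triangle x z y.
all: arc w z; arc a b; arc v b; arc b y.
Qed.

Lemma prism_free u v w x y z : uniq [:: u; v; w; x; y; z] ->
  edges [:: (u, v); (v, w); (w, u); (x, y); (y, z); (z, x);
            (u, x); (v, y); (w, z)] -> False.
Proof.
by unpack; triangle u v w; triangle x y z; arc u x; arc v y; arc w z.
Qed.

Lemma H_d_free u v w x y z a b : uniq [:: u; v; w; x; y; z; a; b] ->
  edges [:: (u, v); (v, w); (w, u); (x, y); (y, z); (z, x); (w, z);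
            (v, y); (w, a); (a, x); (y, b); (b, u); (a, b)] -> False.
Proof.
unpack; triangle u v w; triangle x y z.
all: arc w z; arc v y; arc w a; arc a x; arc y b; arc b u; arc a b.
Qed.

Lemma H_e_free u v w x y z a b c : uniq [:: u; v; w; x; y; z; a; b; c] ->
  edges [:: (u, v); (v, w); (w, u); (x, y); (y, z); (z, x); (w, z);
            (v, y); (w, a); (a, x); (v, c); (c, x); (a, b); (b, c);
            (u, b)] -> False.
Proof.
unpack; triangle u v w; triangle x y z.
all: arc w z; arc v y; arc w a; arc a x; arc v c; arc c x; arc a b; arc b c.
all: arc u b.
Qed.

End ForbiddenSubgraphs.

(** * Embedded subgraphs as lists of vertices *)

(** The even and the odd vertices of the hexagon form the two triangles of the prism; antipodal
    pairs form the matching. *)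
Lemma contains_prism (G : sgraph) : contains G (compl_graph C_6) ->
  contains G (edge_graph 6 [:: (0, 2); (2, 4); (4, 0); (3, 5); (5, 1); (1, 3);
                               (0, 3); (2, 5); (4, 1)]).
Proof.
move=> [h [h_inj he]]; exists h; split=> // x y xy; apply: he; move: xy.
by case: x => [[|[|[|[|[|[|x]]]]]] ltx] //;
  case: y => [[|[|[|[|[|[|y]]]]]] lty].
Qed.

(** Vertices indexed by [nat] let the edge conditions be checked by computation. Beyond [n], [inord]
    takes a default value, hence the restricted injectivity. *)
Lemma contains_nat (G : sgraph) n s : contains G (edge_graph n.+1 s) ->
  exists h : nat -> G, {in gtn n.+1 &, injective h} /\
    forall i j, i < n.+1 -> j < n.+1 -> i != j -> (i, j) \in s ->
      adj (h i) (h j).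
Proof.
move=> [h [h_inj he]]; exists (h \o inord).
split=> [i j lti ltj /= /h_inj eij|].
  by rewrite -(inordK lti) eij inordK.
move=> i j lti ltj nij ijs; apply: he.
by rewrite /= /edge_rel -val_eqE /= !inordK // nij ijs.
Qed.

Lemma colourful_free (G : sgraph) (D : rel G) :
  contains G diamond \/ contains G H_b \/ contains G (compl_graph C_6) \/
    contains G H_d \/ contains G H_e ->
  ~ colourful_Eulerian_orientation D.
Proof.
move=> hG [q [[[Dadj adjD] _] [f [/forallP f_proper f_col]]]].
have arcP x y : adj x y -> D x y \/ D y x.
  by move=> /adjD; case: (D x y) => //=; [left|right].
have proper x y : D x y -> f x <> f y.
  by move=> /Dadj xy; apply/eqP; apply: (implyP (forallP (f_proper x) y)).
have in_in x v y : D x v -> D y v -> f x = f y.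
  by have [c [in_c _ _]] := f_col v; move=> /in_c -> /in_c.
have in_out x v y : D x v -> D v y -> f x <> f y.
  by have [c [in_c out_c _]] := f_col v; move=> /in_c -> /out_c /nesym.
have out_out x v y : D v x -> D v y -> x != y -> f x <> f y.
  by have [c [_ _ out_inj]] := f_col v; move=> vx vy /eqP; apply: out_inj.
have map_uniq n (h : nat -> G) t : {in gtn n &, injective h} ->
    all (gtn n) t -> uniq t -> uniq (map h t).
  move=> h_inj /allP t_n; rewrite map_inj_in_uniq // => i j /t_n ? /t_n.
  exact: h_inj.
case: hG => [|[|[/contains_prism|[|]]]] /contains_nat[h [h_inj he]].
- apply: (diamond_free arcP proper in_in in_out out_out
           (map_uniq _ h [:: 0; 1; 2; 3] h_inj isT isT)).
  by rewrite /= !he.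
- apply: (H_b_free arcP proper in_in in_out out_out
           (map_uniq _ h [:: 0; 1; 2; 3; 4; 5; 6; 7] h_inj isT isT)).
  by rewrite /= !he.
- apply: (prism_free arcP proper in_in in_out out_out
           (map_uniq _ h [:: 0; 2; 4; 3; 5; 1] h_inj isT isT)).
  by rewrite /= !he.
- apply: (H_d_free arcP proper in_in in_out out_out
           (map_uniq _ h [:: 0; 1; 2; 3; 4; 5; 6; 7] h_inj isT isT)).
  by rewrite /= !he.
- apply: (H_e_free arcP proper in_in in_out out_out
           (map_uniq _ h [:: 0; 1; 2; 3; 4; 5; 6; 7; 8] h_inj isT isT)).
  by rewrite /= !he.
Qed.

Lemma degree_ge3 (G : sgraph) d :
  contains G diamond \/ contains G H_b \/ contains G (compl_graph C_6) \/
    contains G H_d \/ contains G H_e ->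
  regular G d -> 2 < d.
Proof.
move=> hG Greg.
suff [v [a [b [c [vs va vb vc]]]]] : exists v a b c : G,
    [/\ uniq [:: a; b; c], adj v a, adj v b & adj v c].
  rewrite -(Greg v) -[3]/(size [:: a; b; c]) -(card_uniqP vs).
  by apply/subset_leq_card/subsetP=> x; rewrite !inE => /or3P[]/eqP->.
have sub n (s : seq (nat * nat)) (v a b c : 'I_n) :
    contains G (edge_graph n s) -> uniq [:: a; b; c] ->
    edge_rel s v a -> edge_rel s v b -> edge_rel s v c ->
  exists v a b c : G, [/\ uniq [:: a; b; c], adj v a, adj v b & adj v c].
  move=> [h [h_inj he]] abc va vb vc; exists (h v), (h a), (h b), (h c).
  by split; [rewrite -(map_inj_uniq h_inj) in abc|exact: he..].
case: hG => [|[|[/contains_prism|[|]]]] hG.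
- by apply: (sub _ _ (@Ordinal 4 1 isT) (@Ordinal 4 0 isT) (@Ordinal 4 2 isT)
              (@Ordinal 4 3 isT) hG).
- by apply: (sub _ _ (@Ordinal 8 0 isT) (@Ordinal 8 1 isT) (@Ordinal 8 2 isT)
              (@Ordinal 8 3 isT) hG).
- by apply: (sub _ _ (@Ordinal 6 0 isT) (@Ordinal 6 2 isT) (@Ordinal 6 3 isT)
              (@Ordinal 6 4 isT) hG).
- by apply: (sub _ _ (@Ordinal 8 1 isT) (@Ordinal 8 0 isT) (@Ordinal 8 2 isT)
              (@Ordinal 8 4 isT) hG).
- by apply: (sub _ _ (@Ordinal 9 1 isT) (@Ordinal 9 0 isT) (@Ordinal 9 2 isT)
              (@Ordinal 9 4 isT) hG).
Qed.

Lemma sum_indegree (T : finType) (D : rel T) :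
  \sum_v #|[set u | D u v]| = \sum_v #|[set w | D v w]|.
Proof.
under eq_bigr do rewrite -sum1dep_card big_mkcond.
rewrite exchange_big; apply: eq_bigr => v _.
by rewrite -big_mkcond sum1dep_card.
Qed.

(** * The orientation induced by a star colouring *)

Section StarColouring.

Variables (G : sgraph) (k : nat) (f : G -> 'I_k).
Hypothesis f_star : star_coloring f.

(** The edge [xy] lies on a bicoloured path with middle [y], so it has to point to [y]. *)
Let another (x y : G) := [exists z, [&& adj y z, z != x & f z == f x]].

(* The enumeration of the vertices orients the edges lying on no bicoloured
   path. *)
Definition star_arc : rel G := fun x y =>
  adj x y && (another x y || ~~ another y x && (enum_rank x < enum_rank y)).

Lemma star_neq x y : adj x y -> f x != f y.
Proof.
by case/andP: f_star => /forallP/(_ x)/forallP/(_ y)/implyP.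
Qed.

(** Otherwise the two bicoloured paths merge into a path z - y - x - t with only two colours; z and
    t differ because their colours are those of [x] and [y]. *)
Lemma another_asym x y : adj x y -> another x y -> ~~ another y x.
Proof.
move=> xy /existsP[z /and3P[yz nzx /eqP fz]].
apply/negP=> /existsP[t /and3P[xt nty /eqP ft]].
have nf := star_neq xy.
have /andP[_ /forallP/(_ [tuple z; y; x; t])/implyP] := f_star.
have P4 : is_P4 [tuple z; y; x; t].
  have nzy : z != y by apply: contraTneq yz => ->; rewrite adj_irrefl.
  have nxt : x != t by apply: contraTneq xt => <-; rewrite adj_irrefl.
  have nzt : z != t by apply: contraNneq nf => ezt; rewrite -fz ezt ft.
  have nyx : y != x by apply: contraTneq xy => ->; rewrite adj_irrefl.
  rewrite /is_P4 /= !inE !negb_or nzy nzx nzt nyx (eq_sym y t) nty nxt.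
  by rewrite (adj_sym z) yz (adj_sym y) xy xt.
move=> /(_ P4); apply/negP; rewrite -leqNgt.
apply: leq_trans (_ : #|[set f x; f y]| <= 2).
  2: by rewrite cards2; case: eqP.
apply/subset_leq_card/subsetP=> c /imsetP[u + ->].
by rewrite !inE => /or4P[]/eqP->; rewrite ?fz ?ft eqxx ?orbT.
Qed.

Lemma star_arc_orientation : orientation star_arc.
Proof.
split=> [u v /andP[]//|u v uv]; rewrite /star_arc uv adj_sym uv /=.
have nr : enum_rank u != enum_rank v :> nat.
  rewrite val_eqE (inj_eq enum_rank_inj).
  by apply: contraTneq uv => ->; rewrite adj_irrefl.
case auv: (another u v); first by rewrite (negPf (another_asym uv auv)).
by case: (another v u) => //=; move: nr; case: ltngtP.
Qed.

Lemma star_arc_bicoloured v x y :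
  adj v x -> adj v y -> x != y -> f x = f y -> ~~ star_arc v x.
Proof.
move=> vx vy nxy fxy.
have axv : another x v.
  by apply/existsP; exists y; rewrite vy eq_sym nxy fxy eqxx.
rewrite adj_sym in vx.
by rewrite /star_arc axv (negPf (another_asym vx axv)) andbF.
Qed.

Lemma star_arc_in_out x v y : star_arc x v -> star_arc v y -> f x != f y.
Proof.
move=> xv vy; have [sub tot] := star_arc_orientation.
apply/eqP=> fxy.
have nxy : x != y.
  apply/eqP=> exy; rewrite -exy in vy.
  by have := tot _ _ (sub _ _ xv); rewrite xv vy.
have vx : adj v x by rewrite adj_sym sub.
have nyx : y != x by rewrite eq_sym.
by have := star_arc_bicoloured (sub _ _ vy) vx nyx (esym fxy); rewrite vy.
Qed.

Lemma star_arc_out_inj v : {in [set w | star_arc v w] &, injective f}.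
Proof.
move=> x y; rewrite !inE => vx vy fxy; apply/eqP/negPn/negP=> nxy.
have [sub _] := star_arc_orientation.
by have := star_arc_bicoloured (sub _ _ vx) (sub _ _ vy) nxy fxy; rewrite vx.
Qed.

(** The out-neighbours use one colour each, the in-neighbours use other colours, and the colour of
    [v] itself is in neither set, which makes the inequality strict. *)
Lemma star_arc_card v :
  #|[set w | star_arc v w]| + #|f @: [set u | star_arc u v]| < k.
Proof.
rewrite -[k in _ < k]card_ord -(card_in_imset (@star_arc_out_inj v)).
have -> : #|f @: [set w | star_arc v w]| + #|f @: [set u | star_arc u v]|
          = #|f @: [set w | star_arc v w] :|: f @: [set u | star_arc u v]|.
  rewrite cardsU; set I := _ :&: _; suff -> : I = set0 by rewrite cards0 subn0.
  apply/setP=> c; rewrite !inE; apply/andP=> -[/imsetP[w + ->] /imsetP[u]].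
  by rewrite !inE => vw uv /eqP; rewrite eq_sym (negPf (star_arc_in_out uv vw)).
rewrite -cardsT; apply/proper_card/properP; split; first exact: subsetT.
exists (f v); rewrite !inE // negb_or.
apply/andP; split; apply/imsetP=> -[w]; rewrite !inE => /andP[vw _] /eqP.
  by rewrite (negPf (star_neq vw)).
by rewrite eq_sym (negPf (star_neq vw)).
Qed.

Lemma star_arc_degree v :
  #|[set w | star_arc v w]| + #|[set u | star_arc u v]| = #|[set u | adj v u]|.
Proof.
have [sub tot] := star_arc_orientation.
rewrite -cardsUI [X in _ + #|pred_of_set X|](_ : _ = set0) ?cards0 ?addn0.
  apply: eq_card => w; rewrite !inE; apply/orP/idP.
    by case=> /sub //; rewrite adj_sym.
  by move=> /tot; case: (star_arc v w) => //=; [left|right].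
apply/setP=> w; rewrite !inE; apply/andP=> -[vw wv].
by have := tot _ _ (sub _ _ vw); rewrite vw wv.
Qed.

Lemma star_arc_colourful d :
  regular G d -> 2 < d -> k.*2 <= d + 4 -> q_colourful k star_arc.
Proof.
move=> Greg d_gt2 k_le.
pose N v := [set u | star_arc u v]; pose M v := [set w | star_arc v w].
have degE v : #|M v| + #|N v| = d by rewrite star_arc_degree Greg.
have card_lt v : #|M v| + #|f @: N v| < k := star_arc_card v.
(* Without in-neighbours the outdegree is [d], so [d < k]; with [k.*2 <= d + 4] this gives
   [d <= 2]. *)
have N_gt0 v : 0 < #|f @: N v|.
  rewrite lt0n cards_eq0 imset_eq0 -cards_eq0; apply/eqP=> N0.
  by have := card_lt v; have := degE v; lia.
(* The outdegree is at most k - 2, hence at most d/2. *)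
have MN_le v : #|M v| <= #|N v|.
  by have := card_lt v; have := degE v; have := N_gt0 v; lia.
(* Both sides have the same sum over all vertices, so each of these inequalities is an equality. *)
have MN v : #|M v| = #|N v|.
  have [_] := leqif_sum (fun v (_ : true) => leqif_eq (MN_le v)).
  by rewrite sum_indegree eqxx => /esym/forallP/(_ v)/eqP.
split; first by split=> [|v]; [exact: star_arc_orientation|rewrite -MN].
exists f; split=> [|v]; first by case/andP: f_star.
(* Now the outdegree is exactly d/2, at least k - 2, which leaves a single colour for the
   in-neighbours. *)
have N1 : #|f @: N v| == 1.
  by have := card_lt v; have := degE v; have := N_gt0 v; have := MN v; lia.
have [c Nc] := cards1P N1; exists c.
have in_c u : star_arc u v -> f u = c.
  by move=> uv; apply/set1P; rewrite -Nc imset_f // inE.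
(* An actual in-neighbour is needed to carry [star_arc_in_out] over to the colour [c]. *)
have [u uN] : exists u, u \in N v.
  by apply/set0Pn; rewrite -(imset_eq0 f) Nc -cards_eq0 cards1.
split=> // [w vw|w w' vw vw' nww' fww'].
  move: uN; rewrite inE => uv; rewrite -(in_c u uv).
  by apply/nesym/eqP/(star_arc_in_out uv).
by apply: nww'; apply: (star_arc_out_inj (v := v)) fww'; rewrite inE.
Qed.

End StarColouring.

(* uphalf n is the ceiling of n / 2. *)
Theorem theorem9 (G : sgraph)
    (hG : contains G diamond \/ contains G H_b \/
          contains G (compl_graph C_6) \/ contains G H_d \/ contains G H_e) :
  ~ (exists D : rel G, colourful_Eulerian_orientation D) /\
  (forall d : nat, regular G d -> uphalf (d + 5) <= chi_s G).
Proof.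
split=> [[D]|d Greg]; first exact: colourful_free.
rewrite /chi_s; case: ex_minnP => k /existsP[f f_star] _.
rewrite leqNgt; apply/negP=> k_lt.
apply: (colourful_free (D := star_arc f) hG); exists k.
(* Being below the ceiling of (d + 5)/2 means exactly [k.*2 <= d + 4]. *)
apply: (star_arc_colourful f_star Greg (degree_ge3 hG Greg)); lia.
Qed.
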